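(* Let $r\ge 3$ and $s$ be coprime odd integers with $0<s<r$, and set $q=\exp(i\pi s/r)$. Then the Riley algebra $\mathbb{Q}[P(r,s)]\cong\mathbb{Q}[t]/(R(t))$ of the two-bridge knot $K(r,s)$ is isomorphic, as a $\mathbb{Q}$-algebra, to the SO$_3$ signed Verlinde algebra $V_q^+$.
   Context: For an integer $n$ put $[n]=\frac{q^n-q^{-n}}{q-q^{-1}}$ (a real number), $[n]!=[n][n-1]\cdots[1]$, and for $1\le n\le r-1$ let $\epsilon_n=\operatorname{sign}[n]=(-1)^{\lfloor ns/r\rfloor}$ (so $\epsilon_1=1$ and $\epsilon_n=\epsilon_{r-n}$). A triple $(i,j,k)\in\{0,\dots,r-2\}^3$ is $r$-admissible if $i\le j+k$, $j\le i+k$, $k\le i+j$, $i+j+k$ is even and $i+j+k\le 2r-4$; for such a triple write $i=b+c$, $j=a+c$, $k=a+b$ and set $\langle i,j,k\rangle=(-1)^{a+b+c}\frac{[a+b+c+1]![a]![b]![c]!}{[a+b]![a+c]![b+c]!}$ (a nonzero real number). Let $V_q$ be the $\mathbb{Q}$-vector space with basis $e_0,\dots,e_{r-2}$, with the symmetric bilinear form $\eta$ for which this basis is orthogonal and $\eta(e_i,e_i)=(-1)^i\epsilon_{i+1}$, and the symmetric trilinear form $\omega$ with $\omega(e_i,e_j,e_k)=\operatorname{sign}\langle i,j,k\rangle$ if $(i,j,k)$ is $r$-admissible and $0$ otherwise. The product on $V_q$ is defined by $\eta(x\cdot y,z)=\omega(x,y,z)$; this makes $V_q$ a commutative associative unital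 $\mathbb{Q}$-algebra with unit $e_0$ and a Frobenius algebra with counit $\epsilon(f)=\eta(f,e_0)$ (so $\eta(x,y)=\epsilon(xy)$). Let $V_q^+\subset V_q$ be the span of $e_0,e_2,\dots,e_{r-3}$; it is a subalgebra, and a Frobenius algebra with the restrictions $\eta^+,\epsilon^+$ of $\eta,\epsilon$. The two-bridge knot $K(r,s)$ has knot group $G=\langle u,v\mid wu=vw\rangle$ with $w=u^{\epsilon_1}v^{\epsilon_2}u^{\epsilon_3}\cdots u^{\epsilon_{r-2}}v^{\epsilon_{r-1}}$. The Riley polynomial $R(t)\in\mathbb{Z}[t]$ is the upper-left entry of the matrix product $A_1A_2\cdots A_{r-1}$, where $A_k=\begin{pmatrix}1&1\\0&1\end{pmatrix}^{\epsilon_k}$ for $k$ odd and $A_k=\begin{pmatrix}1&0\\t&1\end{pmatrix}^{\epsilon_k}$ for $k$ even. $P(r,s)$ denotes the set of conjugacy classes of representations $\rho:G\to\mathrm{SL}_2(\mathbb{C})$ with $\rho(u)$ parabolic; it is a $0$-dimensional variety over $\mathbb{Q}$ whose algebra of functions $\mathbb{Q}[P(r,s)]$ is $\mathbb{Q}[t]/(R(t))$. *)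

(* Defs.v *)
From HB Require Import structures.
From mathcomp Require Import all_boot all_order all_algebra.
Set Implicit Arguments. Unset Strict Implicit. Unset Printing Implicit Defensive.
Import Order.TTheory GRing.Theory Num.Theory.
Local Open Scope ring_scope.

(* epsilon_n = sign [n] = (-1)^(floor (n s / r)), for 1 <= n <= r-1 *)
Definition eps (r s n : nat) : int := (-1) ^+ ((n * s) %/ r)%N.

(* sign of the quantum factorial [n]! = [n][n-1]...[1] *)
Definition sfact (r s n : nat) : int := \prod_(1 <= m < n.+1) eps r s m.

Definition radmissible (r i j k : nat) : bool :=
  [&& (i <= r - 2)%N, (j <= r - 2)%N, (k <= r - 2)%N,
      (i <= j + k)%N, (j <= i + k)%N, (k <= i + j)%N,
      ~~ odd (i + j + k) & (i + j + k <= 2 * r - 4)%N].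

(* sign <i,j,k>, with i = b+c, j = a+c, k = a+b;
   sign of (-1)^(a+b+c) [a+b+c+1]![a]![b]![c]! / ([a+b]![a+c]![b+c]!) *)
Definition sign_tri (r s i j k : nat) : int :=
  let a := ((j + k - i) %/ 2)%N in
  let b := ((i + k - j) %/ 2)%N in
  let c := ((i + j - k) %/ 2)%N in
  (-1) ^+ (a + b + c) * sfact r s (a + b + c).+1 * sfact r s a * sfact r s b
  * sfact r s c * sfact r s (a + b) * sfact r s (a + c) * sfact r s (b + c).

Definition omega (r s i j k : nat) : rat :=
  if radmissible r i j k then (sign_tri r s i j k)%:~R else 0.

Definition eta (r s i : nat) : rat := ((-1) ^+ i * eps r s i.+1)%:~R.

Notation Vq r := ('rV[rat]_(r.-1)).

Definition ebasis (r i : nat) : Vq r := \row_(k < r.-1) ((k == i :> nat)%:R).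

(* the product determined by eta(x.y, z) = omega(x, y, z), eta being
   diagonal with entries +-1 in the basis e_k *)
Definition vmul (r s : nat) (x y : Vq r) : Vq r :=
  \row_(k < r.-1) ((\sum_(i < r.-1) \sum_(j < r.-1)
                     x 0 i * y 0 j * omega r s i j k) / eta r s k).

Definition Vplus (r : nat) (v : Vq r) : Prop :=
  forall k : 'I_(r.-1), odd k -> v 0 k = 0.

Definition Umat : 'M[{poly rat}]_2 := 1 + delta_mx 0 1.
Definition Lmat : 'M[{poly rat}]_2 := 1 + 'X *: delta_mx 1 0.
Definition Amat (r s k : nat) : 'M[{poly rat}]_2 :=
  (if odd k then Umat else Lmat) ^ (eps r s k).
Definition riley (r s : nat) : {poly rat} :=
  (\prod_(1 <= k < r) Amat r s k) 0 0.

Arguments vmul : clear implicits.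
Arguments Vplus : clear implicits.
Arguments ebasis : clear implicits.

(* Main.v *)
Require Import Defs.
From HB Require Import structures.
From mathcomp Require Import all_boot all_order all_algebra.
From mathcomp Require Import zify ring.
Set Implicit Arguments. Unset Strict Implicit. Unset Printing Implicit Defensive.
Import Order.TTheory GRing.Theory Num.Theory.
Local Open Scope ring_scope.

(* The matrix M with e_i M = e_{i+1} - eps_i eps_{i+1} e_{i-1} is
   multiplication by e_1 in V_q, so e_i is the i-th continuant in e_1, and
   e_{r-1} = 0.  Up to the sign eps_1 ... eps_i these are the continuants in the
   first row of the Riley matrix product, with t = e_1 ^ 2; hence t |-> e_1 ^ 2
   kills the Riley polynomial, and comparing degrees shows that nothing else is
   killed.  That M really commutes with the product defined by omega is a
   four-term relation between signs of triangle coefficients.  In the parameters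
   a, b, c with i+1 = b+c, j+1 = a+c, l+1 = a+b it reduces to counting the carries
   in floor ((a+b+c)s/r). *)

(** * Signs of quantum integers and factorials *)

Lemma eps_sqr r s n : eps r s n * eps r s n = 1.
Proof. by rewrite -expr2 /eps sqrr_sign. Qed.

Lemma sfact0 r s : sfact r s 0 = 1.
Proof. by rewrite /sfact big_nil. Qed.

Lemma sfactS r s n : sfact r s n.+1 = sfact r s n * eps r s n.+1.
Proof. by rewrite /sfact big_nat_recr. Qed.

Lemma sfact_sqr r s n : sfact r s n * sfact r s n = 1.
Proof. by elim: n => [|n IH]; rewrite ?sfact0 // sfactS mulrACA IH eps_sqr. Qed.

(** Since [r] does not divide [n * s], the floor of [(r - n) * s / r] is [s - 1] minus that of
    [n * s / r], and [s - 1] is even. *)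
Lemma eps_sub r s n : (0 < s)%N -> odd s -> coprime r s -> (0 < n < r)%N ->
  eps r s (r - n) = eps r s n.
Proof.
move=> s0 os co /andP[n0 nr].
rewrite /eps -signr_odd -[RHS]signr_odd; congr (_ ^+ _).
have nd : (n * s %% r)%N != 0%N.
  rewrite -/(dvdn r (n * s)) Gauss_dvdl //.
  by apply/negP => /dvdn_leq; lia.
have r0 : (0 < r)%N by lia.
have e : ((r - n) * s %/ r = s.-1 - n * s %/ r)%N.
  have h1 := divn_eq (n * s) r; have h2 := ltn_pmod (n * s) r0.
  have hlt : (n * s %/ r < s)%N by rewrite ltn_divLR // mulnC ltn_pmul2l.
  have -> : ((r - n) * s = (s.-1 - n * s %/ r) * r + (r - n * s %% r))%N.
    have -> : (s.-1 - n * s %/ r = s - (n * s %/ r).+1)%N by lia.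
    rewrite !mulnBl {1}h1 mulSn (mulnC r s).
    have : ((n * s %/ r).+1 * r <= s * r)%N by rewrite leq_mul2r hlt orbT.
    by rewrite mulSn; lia.
  have lt : (r - n * s %% r < r)%N by rewrite ltn_subrL lt0n nd.
  by rewrite divnMDl // (divn_small lt) addn0.
have hlt : (n * s %/ r < s)%N by rewrite ltn_divLR // mulnC ltn_pmul2l.
rewrite e; move: (n * s %/ r)%N hlt => m hlt.
by rewrite oddB; lia.
Qed.

(* Writing f(n) = floor (ns/r), both f(a+b+c) - f(a) - f(b) - f(c) = 0 and = 2
   force the carries in f(a+b) and f(b+c) to be equal; if the difference is 1 both
   sides vanish. *)
Lemma eps_carry r s a b c : (0 < r)%N ->
  eps r s (a + b) * (eps r s (a + b + c) * eps r s a * eps r s b + eps r s c) =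
  eps r s (b + c) * (eps r s (a + b + c) * eps r s b * eps r s c + eps r s a).
Proof.
move=> r0; rewrite /eps.
have D m n : ((m + n) * s %/ r = m * s %/ r + n * s %/ r + (r <= m * s %% r + n * s %% r))%N.
  by rewrite mulnDl divnD.
have := D a (b + c)%N; rewrite addnA (D (a + b)%N c) (D a b) (D b c).
do 4!case: (r <= _)%N; rewrite ?addn0 ?addn1 => h; try lia.
all: rewrite !(exprD, exprS).
all: move: (a * s %/ r)%N (b * s %/ r)%N (c * s %/ r)%N => x y z.
all: rewrite -(signr_odd _ x) -(signr_odd _ y) -(signr_odd _ z).
all: by case: (odd x) (odd y) (odd z) => [] [] [].
Qed.

(** * Signs of triangle coefficients and the four-term relation *)

Definition tri r s a b c : int :=
  (-1) ^+ (a + b + c) * sfact r s (a + b + c).+1 * sfact r s a * sfact r s b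
  * sfact r s c * sfact r s (a + b) * sfact r s (a + c) * sfact r s (b + c).

(** Lets [omega] be computed without halvings; the bound on [a + b + c] is half of
    [i + j + k <= 2r - 4]. *)
Lemma omega_tri r s i j k a b c :
  i = (b + c)%N -> j = (a + c)%N -> k = (a + b)%N -> (a + b + c <= r - 2)%N ->
  omega r s i j k = (tri r s a b c)%:~R.
Proof.
move=> -> -> -> le; rewrite /omega ifT; last first.
  by rewrite /radmissible; lia.
rewrite /sign_tri /tri.
have -> : ((a + c + (a + b) - (b + c)) %/ 2 = a)%N by lia.
have -> : ((b + c + (a + b) - (a + c)) %/ 2 = b)%N by lia.
by have -> : ((b + c + (a + c) - (a + b)) %/ 2 = c)%N by lia.
Qed.

Lemma omega_eq0 r s i j k : ~~ radmissible r i j k -> omega r s i j k = 0.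
Proof. by rewrite /omega => /negbTE ->. Qed.

Lemma tri_perm12 r s a b c : tri r s a b c = tri r s b a c.
Proof. by rewrite /tri (addnC b a); ring. Qed.

Lemma tri_perm23 r s a b c : tri r s a b c = tri r s a c b.
Proof. by rewrite /tri (addnAC a c b) (addnC c b); ring. Qed.

(** The triangle is degenerate, one side being the sum of the other two, and the factorial signs
    pair off up to one quantum integer. *)
Lemma tri_degen r s b c : tri r s 0 b c = (-1) ^+ (b + c) * eps r s (b + c).+1.
Proof.
rewrite /tri !add0n sfact0 sfactS.
transitivity ((-1) ^+ (b + c) * eps r s (b + c).+1 * (sfact r s b * sfact r s b)
  * (sfact r s c * sfact r s c) * (sfact r s (b + c) * sfact r s (b + c))).
  by ring.
by rewrite !sfact_sqr !mulr1.
Qed.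

(** The generic case of the four-term relation. The boolean multiplicities discard the two larger
    triangles when they stop being admissible, that is when [a + b + c + 3 = r]. There the symmetry
    [eps_sub] suffices; otherwise the relation is a multiple of [eps_carry]. *)
Lemma tri_rec r s a b c : odd s -> (0 < s)%N -> coprime r s ->
  (a + b + c + 3 <= r)%N ->
  tri r s a.+1 b.+1 c *+ (a + b + c + 3 < r)%N
    - eps r s (a + b).+1 * eps r s (a + b).+2 * tri r s a b c.+1
  = tri r s a b.+1 c.+1 *+ (a + b + c + 3 < r)%N
    - eps r s (b + c).+1 * eps r s (b + c).+2 * tri r s a.+1 b c.
Proof.
move=> os s0 co; rewrite leq_eqVlt => /predU1P[er | lt].
  (* On this boundary [a + b + 2] and [c + 1] add up to [r], and so do [b + c + 2] and [a + 1]. *)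
  have ec : eps r s (a + b).+2 = eps r s c.+1.
    by rewrite -(@eps_sub r s c.+1) //; [congr eps; lia | lia].
  have ea : eps r s (b + c).+2 = eps r s a.+1.
    by rewrite -(@eps_sub r s a.+1) //; [congr eps; lia | lia].
  rewrite er ltnn !mulr0n !sub0r ec ea; congr (- _).
  set D := (-1) ^+ (a + b + c).+1 * sfact r s (a + b + c).+2 * sfact r s a * sfact r s b
    * sfact r s c * sfact r s (a + b).+1 * sfact r s (a + c).+1 * sfact r s (b + c).+1.
  transitivity (D * (eps r s c.+1 * eps r s c.+1)).
    by rewrite /D /tri !(addnS, addSn) (sfactS _ _ c) (sfactS _ _ (a + b)); ring.
  rewrite eps_sqr -(eps_sqr r s a.+1).
  by rewrite /D /tri !(addnS, addSn) (sfactS _ _ a) (sfactS _ _ (b + c)); ring.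
rewrite lt !mulr1n; apply/eqP; rewrite -subr_eq0; apply/eqP.
have := @eps_carry r s a.+1 b.+1 c.+1; rewrite !(addnS, addSn) => carry.
set D := (-1) ^+ (a + b + c) * sfact r s (a + b + c).+2 * sfact r s a * sfact r s b
    * sfact r s c * sfact r s (a + b).+1 * sfact r s (a + c).+1 * sfact r s (b + c).+1.
(* The difference of the two sides is [D] times the difference of the two sides of [carry]. *)
rewrite -[RHS](mulr0 D) -(subrr (eps r s (b + c).+2 * (eps r s (a + b + c).+3 *
  eps r s b.+1 * eps r s c.+1 + eps r s a.+1))) -{1}carry; last lia.
rewrite /D /tri !(addnS, addSn) (sfactS _ _ (a + b).+1) (sfactS _ _ (b + c).+1)
  (sfactS _ _ (a + b + c).+2) (sfactS _ _ (a + b)) (sfactS _ _ (b + c))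
  (sfactS _ _ a) (sfactS _ _ b) (sfactS _ _ c) !exprS.
by ring.
Qed.

(* Associativity (e_1 e_i) e_j = e_1 (e_i e_j), paired with e_l. *)
Lemma omega_rec r s i j l : odd s -> (0 < s)%N -> coprime r s -> (3 <= r)%N ->
  (i < r.-1)%N -> (j < r.-1)%N -> (l < r.-1)%N ->
  omega r s i j l.+1
    - (eps r s l * eps r s l.+1)%:~R * (if (0 < l)%N then omega r s i j l.-1 else 0)
  = omega r s i.+1 j l
    - (eps r s i * eps r s i.+1)%:~R * (if (0 < i)%N then omega r s i.-1 j l else 0).
Proof.
move=> os s0 co r3 ir jr lr.
(* When this condition fails, none of the four triples is admissible. *)
have [adm | nadm] := boolP [&& odd (i + j + l), (i <= j + l.+1)%N, (j <= i + l.+1)%N,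
   (l <= i + j.+1)%N & (i + j + l + 3 <= 2 * r)%N]; last first.
  have -> : omega r s i j l.+1 = 0 by apply: omega_eq0; rewrite /radmissible; lia.
  have -> : omega r s i.+1 j l = 0 by apply: omega_eq0; rewrite /radmissible; lia.
  have -> : (if (0 < l)%N then omega r s i j l.-1 else 0) = 0.
    by case: ifP => // l0; apply: omega_eq0; rewrite /radmissible; lia.
  have -> : (if (0 < i)%N then omega r s i.-1 j l else 0) = 0.
    by case: ifP => // l0; apply: omega_eq0; rewrite /radmissible; lia.
  by rewrite !mulr0.
have [a [b [c [ei ej el le]]]] : exists a b c,
    [/\ i.+1 = (b + c)%N, j.+1 = (a + c)%N, l.+1 = (a + b)%N & (a + b + c <= r)%N].
  exists ((j + l.+1 - i) %/ 2)%N, ((i + l.+1 - j) %/ 2)%N, ((i + j.+1 - l) %/ 2)%N.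
  by split; lia.
(* Two zero parameters would force [i + 1], [j + 1] or [l + 1] to be zero. With exactly one zero,
   two of the four terms survive, both degenerate. *)
case: a b c => [|a] [|b] [|c] in ei ej el le *; try by [|lia].
- rewrite (@omega_tri r s i j l.+1 0 b.+1 c); try lia.
  rewrite (@omega_eq0 r s i.+1 j l); last by rewrite /radmissible; lia.
  have -> : (if (0 < l)%N then omega r s i j l.-1 else 0) = 0.
    by case: ifP => // l0; apply: omega_eq0; rewrite /radmissible; lia.
  rewrite ifT; last lia.
  rewrite (@omega_tri r s i.-1 j l 0 b c); try lia.
  have -> : i = (b + c).+1 by lia.
  rewrite mulr0 subr0 sub0r -rmorphM -rmorphN /=; congr (_%:~R).
  rewrite !tri_degen addSn exprS.
  transitivity (- (-1) ^+ (b + c) * eps r s (b + c).+2 *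
    (eps r s (b + c).+1 * eps r s (b + c).+1)); last by ring.
  by rewrite eps_sqr; ring.
- rewrite (@omega_tri r s i j l.+1 a.+1 0 c); try lia.
  rewrite (@omega_tri r s i.+1 j l a 0 c.+1); try lia.
  have -> : (if (0 < l)%N then omega r s i j l.-1 else 0) = 0.
    by case: ifP => // l0; apply: omega_eq0; rewrite /radmissible; lia.
  have -> : (if (0 < i)%N then omega r s i.-1 j l else 0) = 0.
    by case: ifP => // l0; apply: omega_eq0; rewrite /radmissible; lia.
  by rewrite !mulr0 !subr0 !(tri_perm12 _ _ _ 0) !tri_degen addnS addSn.
- rewrite (@omega_eq0 r s i j l.+1); last by rewrite /radmissible; lia.
  rewrite (@omega_tri r s i.+1 j l a b.+1 0); try lia.
  rewrite ifT; last lia.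
  have -> : (if (0 < i)%N then omega r s i.-1 j l else 0) = 0.
    by case: ifP => // l0; apply: omega_eq0; rewrite /radmissible; lia.
  rewrite (@omega_tri r s i j l.-1 a b 0); try lia.
  have -> : l = (a + b).+1 by lia.
  rewrite mulr0 subr0 sub0r -rmorphM -rmorphN /=; congr (_%:~R).
  rewrite !(tri_perm23 _ _ _ _ 0) !(tri_perm12 _ _ _ 0) !tri_degen addnS exprS.
  transitivity (- (-1) ^+ (a + b) * eps r s (a + b).+2 *
    (eps r s (a + b).+1 * eps r s (a + b).+1)); first by ring.
  by rewrite eps_sqr; ring.
- have T1 : omega r s i j l.+1 = (tri r s a.+1 b.+1 c *+ (a + b + c + 3 < r)%N)%:~R.
    case: ltnP => h; first by rewrite mulr1n; apply: omega_tri; lia.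
    by rewrite mulr0n; apply: omega_eq0; rewrite /radmissible; lia.
  have T3 : omega r s i.+1 j l = (tri r s a b.+1 c.+1 *+ (a + b + c + 3 < r)%N)%:~R.
    case: ltnP => h; first by rewrite mulr1n; apply: omega_tri; lia.
    by rewrite mulr0n; apply: omega_eq0; rewrite /radmissible; lia.
  rewrite T1 T3 !ifT; try lia.
  rewrite (@omega_tri r s i j l.-1 a b c.+1); try lia.
  rewrite (@omega_tri r s i.-1 j l a.+1 b c); try lia.
  rewrite -!rmorphM -!rmorphB /=; congr (_%:~R).
  have -> : l = (a + b).+1 by lia.
  have -> : i = (b + c).+1 by lia.
  by apply: tri_rec => //; lia.
Qed.

(** * Multiplication by [e_1] as a matrix *)

Lemma sum_ord_delta (R : pzRingType) n m (F : nat -> R) :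
  \sum_(i < n) (i == m :> nat)%:R * F i = if (m < n)%N then F m else 0.
Proof.
case: ltnP => [lt | ge].
  rewrite (bigD1 (Ordinal lt)) //= eqxx mul1r big1 ?addr0 // => i.
  by rewrite -val_eqE /= => /negbTE ->; rewrite mul0r.
by apply: big1 => i _; rewrite ltn_eqF ?mul0r // (leq_trans (ltn_ord i)).
Qed.

(** Acts on row vectors from the right. The terms in [e_{-1}] and [e_{r-1}] disappear because no
    column carries these indices. *)
Definition stepmx (r s : nat) : 'M[rat]_(r.-1) := \matrix_(i, l)
  ((l == i.+1 :> nat)%:R - (eps r s i * eps r s i.+1)%:~R * (i == l.+1 :> nat)%:R).

(** Supplies [e_{r-1} = 0], the relation that makes the Riley polynomial vanish. *)
Lemma ebasis_eq0 r i : (r.-1 <= i)%N -> ebasis r i = 0.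
Proof.
move=> le; apply/rowP => k; rewrite !mxE ltn_eqF //.
exact: leq_trans (ltn_ord k) le.
Qed.

Lemma ebasis_stepmx r s i : (i < r.-1)%N ->
  ebasis r i *m stepmx r s = ebasis r i.+1
    - (if (0 < i)%N then (eps r s i * eps r s i.+1)%:~R *: ebasis r i.-1 else 0).
Proof.
move=> ir; apply/rowP => l; rewrite !mxE.
under eq_bigr => k _ do rewrite !mxE.
rewrite (sum_ord_delta _ i (fun k => (l == k.+1 :> nat)%:R
  - (eps r s k * eps r s k.+1)%:~R * (k == l.+1 :> nat)%:R)) ir; congr (_ - _).
case: i ir => [|i] ir; first by rewrite mxE mulr0.
by rewrite !mxE eqSS eq_sym.
Qed.

Lemma eta_neq0 r s k : Defs.eta r s k != 0.
Proof. by rewrite intr_eq0 mulf_neq0 ?signr_eq0. Qed.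

Lemma sum_stepmx_omega r s i j l : (i < r.-1)%N ->
  \sum_(k < r.-1) ((k == i.+1 :> nat)%:R
      - (eps r s i * eps r s i.+1)%:~R * (i == k.+1 :> nat)%:R) * omega r s k j l
  = omega r s i.+1 j l
    - (eps r s i * eps r s i.+1)%:~R * (if (0 < i)%N then omega r s i.-1 j l else 0).
Proof.
move=> ir; under eq_bigr => k _ do rewrite mulrBl -mulrA.
rewrite sumrB -mulr_sumr (sum_ord_delta _ _ (fun k => omega r s k j l)); congr (_ - _ * _).
  by case: ltnP => // le; rewrite omega_eq0 // /radmissible; lia.
case: i ir => [|i] ir; first by apply: big1 => k _; rewrite mul0r.
under eq_bigr => k _ do rewrite eqSS eq_sym.
by rewrite (sum_ord_delta _ _ (fun k => omega r s k j l)) ltnW.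
Qed.

(** Expresses that [stepmx] is self-adjoint for [eta], which is the sign identity [S2] below. *)
Lemma sum_omega_stepmx r s i j l : (l < r.-1)%N ->
  \sum_(k < r.-1) omega r s i j k / Defs.eta r s k * ((l == k.+1 :> nat)%:R
      - (eps r s k * eps r s k.+1)%:~R * (k == l.+1 :> nat)%:R)
  = (omega r s i j l.+1 - (eps r s l * eps r s l.+1)%:~R *
      (if (0 < l)%N then omega r s i j l.-1 else 0)) / Defs.eta r s l.
Proof.
move=> lr.
transitivity (\sum_(k < r.-1) (l == k.+1 :> nat)%:R * (omega r s i j k / Defs.eta r s k)
  - \sum_(k < r.-1) (k == l.+1 :> nat)%:R * (omega r s i j k / Defs.eta r s k *
       (eps r s k * eps r s k.+1)%:~R)).
  by rewrite -sumrB; apply: eq_bigr => k _; ring.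
rewrite (sum_ord_delta _ _ (fun k => omega r s i j k / Defs.eta r s k *
       (eps r s k * eps r s k.+1)%:~R)).
(* At the last index the sum has no such term, but [omega] is zero there as well, [r - 1] being out
   of the admissible range. *)
have -> : (if (l.+1 < r.-1)%N then omega r s i j l.+1 / Defs.eta r s l.+1 *
       (eps r s l.+1 * eps r s l.+2)%:~R else 0) = omega r s i j l.+1 / Defs.eta r s l.+1 *
       (eps r s l.+1 * eps r s l.+2)%:~R.
  by case: ltnP => // le; rewrite omega_eq0 ?mul0r // /radmissible; lia.
have etaV k : (Defs.eta r s k)^-1 = Defs.eta r s k.
  apply: (mulIf (eta_neq0 r s k)); rewrite mulVf ?eta_neq0 // /Defs.eta -rmorphM /=.
  by rewrite mulrACA -expr2 sqrr_sign eps_sqr.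
have S2 m : Defs.eta r s m.+1 * (eps r s m.+1 * eps r s m.+2)%:~R = - Defs.eta r s m.
  rewrite /Defs.eta exprS -rmorphM -rmorphN /=; congr _%:~R.
  by rewrite -[RHS]mulr1 -[X in _ = _ * X](eps_sqr r s m.+2); ring.
rewrite !etaV -mulrA S2.
case: l lr => [|l] lr.
  rewrite big1 ?sub0r; last by move=> k _; rewrite mul0r.
  by rewrite mulr0 subr0; ring.
under eq_bigr => k _ do rewrite eqSS eq_sym.
rewrite (sum_ord_delta _ _ (fun k => omega r s i j k / Defs.eta r s k)) ltnW //= etaV.
have -> : Defs.eta r s l = - (Defs.eta r s l.+1 * (eps r s l.+1 * eps r s l.+2)%:~R).
  by rewrite S2 opprK.
ring.
Qed.

(** By bilinearity it is enough to compare structure constants, where the claim is [omega_rec].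
    Multiplicativity of the final map rests on this instance of associativity. *)
Lemma vmul_stepmx r s (x y : 'rV[rat]_(r.-1)) :
  odd s -> (0 < s)%N -> coprime r s -> (3 <= r)%N ->
  vmul r s (x *m stepmx r s) y = vmul r s x y *m stepmx r s.
Proof.
move=> os s0 co r3; apply/rowP => l; rewrite !mxE.
transitivity (\sum_i \sum_(j < r.-1) x 0 i * y 0 j *
  ((\sum_(k < r.-1) stepmx r s i k * omega r s k j l) / Defs.eta r s l)).
  rewrite mulr_suml (eq_bigr (fun k : 'I_r.-1 => \sum_i \sum_(j < r.-1) x 0 i * y 0 j *
    (stepmx r s i k * omega r s k j l) / Defs.eta r s l)) => [|k _]; last first.
    rewrite exchange_big mulr_suml; apply: eq_bigr => j _.
    by rewrite mxE !mulr_suml; apply: eq_bigr => i _; ring.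
  rewrite exchange_big; apply: eq_bigr => i _.
  rewrite exchange_big; apply: eq_bigr => j _.
  by rewrite mulr_suml mulr_sumr; apply: eq_bigr => k _; ring.
transitivity (\sum_i \sum_(j < r.-1) x 0 i * y 0 j *
  (\sum_(k < r.-1) omega r s i j k / Defs.eta r s k * stepmx r s k l)).
  apply: eq_bigr => i _; apply: eq_bigr => j _; congr (_ * _).
  under eq_bigr => k _ do rewrite mxE.
  under [RHS]eq_bigr => k _ do rewrite mxE.
  by rewrite sum_stepmx_omega // sum_omega_stepmx // omega_rec.
symmetry; under eq_bigr => k _ do rewrite mxE !mulr_suml.
rewrite exchange_big; apply: eq_bigr => i _.
under eq_bigr => k _ do rewrite !mulr_suml.
rewrite exchange_big; apply: eq_bigr => j _.
by rewrite mulr_sumr; apply: eq_bigr => k _; ring.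
Qed.

Lemma vmul_linearl r s a (x x' y : 'rV[rat]_(r.-1)) :
  vmul r s (a *: x + x') y = a *: vmul r s x y + vmul r s x' y.
Proof.
apply/rowP => k; rewrite !mxE mulrA -mulrDl mulr_sumr -big_split /=; congr (_ / _).
apply: eq_bigr => i _; rewrite mulr_sumr -big_split; apply: eq_bigr => j _ /=.
by rewrite !mxE; ring.
Qed.

(** Only the degenerate triangles [(0, k, k)] contribute, and their sign is exactly [eta], which the
    division cancels. *)
Lemma vmul_ebasis0 r s (y : 'rV[rat]_(r.-1)) : vmul r s (ebasis r 0) y = y.
Proof.
apply/rowP => k; rewrite mxE.
have k0 := leq_ltn_trans (leq0n _) (ltn_ord k).
rewrite (eq_bigr (fun i : 'I_r.-1 => (i == 0 :> nat)%:R *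
  \sum_(j < r.-1) y 0 j * omega r s i j k)) => [|i _]; last first.
  by rewrite mulr_sumr; apply: eq_bigr => j _; rewrite mxE; ring.
rewrite (sum_ord_delta _ _ (fun i => \sum_(j < r.-1) y 0 j * omega r s i j k)) k0.
rewrite (bigD1 k) //= big1 => [|j jk]; last first.
  rewrite omega_eq0 ?mulr0 //; move: jk; rewrite -val_eqE /radmissible /=; lia.
rewrite (@omega_tri r s 0 k k k 0 0) ?addn0 //; last by have := ltn_ord k; lia.
rewrite !(tri_perm12 _ _ _ 0) tri_degen addn0 addr0 -/(Defs.eta r s k) mulfK //.
exact: eta_neq0.
Qed.

(** * Continuants in the Riley matrix product *)

(** The exponent is 1 or -1, and [1 - N] is the inverse of [1 + N]. *)
Lemma unipotent_exp_eps (R : unitRingType) (N : R) r s k :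
  N * N = 0 -> (1 + N) ^ (eps r s k) = 1 + N *~ eps r s k.
Proof.
move=> N2; rewrite /eps -signr_odd; case: (odd _); last by rewrite expr1z mulr1z.
rewrite expr1 mulrN1z exprN1.
have e1 : (1 - N) * (1 + N) = 1 by rewrite mulrDr mulr1 mulrBl mul1r N2 subr0 subrK.
have e2 : (1 + N) * (1 - N) = 1 by rewrite mulrDl mul1r mulrBr mulr1 N2 subr0 subrK.
have U : (1 + N) \is a GRing.unit by apply/unitrP; exists (1 - N).
by apply: (mulrI U); rewrite mulrV.
Qed.

(** Entry 0 of the row changes only at even [n] and entry 1 only at odd [n]; the entries just
    changed form the continuant sequence. *)
Definition continuant (r s n : nat) (i : 'I_2) : {poly rat} :=
  (\prod_(1 <= k < n.+1) Amat r s k) 0 i.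

Lemma Amat_odd r s k : odd k ->
  Amat r s k = 1 + (eps r s k)%:~R *: delta_mx 0 1.
Proof.
move=> ok; rewrite /Amat ok unipotent_exp_eps ?scaler_int //.
by rewrite -mulmxE mul_delta_mx_0.
Qed.

Lemma Amat_even r s k : ~~ odd k ->
  Amat r s k = 1 + ((eps r s k)%:~R * 'X) *: delta_mx 1 0.
Proof.
move=> /negbTE ok; rewrite /Amat ok unipotent_exp_eps -?scalerA ?scaler_int //.
by rewrite -scalerAl -scalerAr -mulmxE mul_delta_mx_0 ?scaler0.
Qed.

Lemma continuantS r s n i :
  continuant r s n.+1 i = continuant r s n 0 * Amat r s n.+1 0 i
    + continuant r s n 1 * Amat r s n.+1 1 i.
Proof.
rewrite /continuant big_nat_recr //= mxE 2!big_ord_recl big_ord0 addr0.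
by have -> : lift ord0 ord0 = 1 :> 'I_2 by apply/val_inj.
Qed.

Lemma continuant0 r s i : continuant r s 0 i = (i == 0)%:R.
Proof. by rewrite /continuant big_nil mxE eq_sym. Qed.

Lemma continuant_odd r s n : ~~ odd n ->
  continuant r s n.+1 0 = continuant r s n 0 /\
  continuant r s n.+1 1 = continuant r s n 1 + (eps r s n.+1)%:~R * continuant r s n 0.
Proof.
by move=> en; rewrite !continuantS Amat_odd //= !mxE /=; split; ring.
Qed.

Lemma continuant_even r s n : odd n ->
  continuant r s n.+1 0 = continuant r s n 0
    + (eps r s n.+1)%:~R * (continuant r s n 1 * 'X) /\
  continuant r s n.+1 1 = continuant r s n 1.
Proof.
by move=> on; rewrite !continuantS Amat_even /= ?on // !mxE /=; split; ring.
Qed.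

(** Together with [continuant_doubleSS] this is the three-term recurrence of the interleaved
    sequence, entry 0 at even indices and entry 1 at odd ones. *)
Lemma continuant_doubleS r s m :
  continuant r s m.+1.*2 0 = continuant r s m.*2 0
    + (eps r s m.+1.*2)%:~R * (continuant r s m.*2.+1 1 * 'X).
Proof.
rewrite doubleS; case: (@continuant_even r s m.*2.+1) => [|-> _].
  by rewrite /= odd_double.
by case: (@continuant_odd r s m.*2) => [|-> _] //; rewrite odd_double.
Qed.

Lemma continuant_doubleSS r s m :
  continuant r s m.+1.*2.+1 1 = continuant r s m.*2.+1 1
    + (eps r s m.+1.*2.+1)%:~R * continuant r s m.+1.*2 0.
Proof.
case: (@continuant_odd r s m.+1.*2) => [|_ ->]; first by rewrite odd_double.
rewrite doubleS; case: (@continuant_even r s m.*2.+1) => [|_ ->] //.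
by rewrite /= odd_double.
Qed.

Lemma continuant1 r s : continuant r s 1 1 = (eps r s 1)%:~R.
Proof.
case: (@continuant_odd r s 0) => // _ ->; by rewrite !continuant0 eqxx mulr1 /= add0r.
Qed.

Lemma size_eps_mul r s k (p : {poly rat}) : size ((eps r s k)%:~R * p) = size p.
Proof.
rewrite /eps -signr_odd; case: (odd _); last by rewrite mul1r.
by rewrite expr1 mulN1r size_polyN.
Qed.

(** Only the even steps multiply by ['X], so the degree grows by one every two steps; the newest
    term never has its leading coefficient cancelled. *)
Lemma size_continuant r s m :
  size (continuant r s m.*2 0) = m.+1 /\ size (continuant r s m.*2.+1 1) = m.+1.
Proof.
elim: m => [|m [IH0 IH1]].
  by rewrite continuant1 -[_%:~R]mulr1 size_eps_mul continuant0 size_poly1.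
have h : size (continuant r s m.+1.*2 0) = m.+2.
  rewrite continuant_doubleS addrC size_polyDl size_eps_mul size_mulX ?IH0 ?IH1 //.
    by rewrite -size_poly_gt0 IH1.
  by rewrite -size_poly_gt0 IH1.
by split=> //; rewrite continuant_doubleSS addrC size_polyDl size_eps_mul ?h ?IH1.
Qed.

(** * The homomorphism sending [t] to [e_1 ^ 2] *)

Definition riley_hom (n s : nat) (p : {poly rat}) : 'rV[rat]_n.+1 :=
  ebasis n.+2 0 *m horner_mx ((stepmx n.+2 s : 'M_n.+1) ^+ 2) p.

Lemma mulmx_sqr (R : pzRingType) n (v : 'rV[R]_n.+1) (A : 'M[R]_n.+1) :
  v *m A ^+ 2 = v *m A *m A.
Proof. by rewrite expr2 -mulmxE mulmxA. Qed.

Section RileyHom.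
Variables (n s : nat).
Hypotheses (odd_s : odd s) (s_gt0 : (0 < s)%N) (co_rs : coprime n.+2 s).
Hypothesis r_ge3 : (3 <= n.+2)%N.
Local Notation r := n.+2.
Local Notation M := (stepmx n.+2 s : 'M[rat]_n.+1).
Local Notation phi := (riley_hom n s).

Lemma riley_hom_linear a p q : phi (a *: p + q) = a *: phi p + phi q.
Proof. by rewrite /riley_hom linearP /= mulmxDr scalemxAr. Qed.

Lemma riley_homMX p : phi (p * 'X) = phi p *m M *m M.
Proof. by rewrite /riley_hom rmorphM /= horner_mx_X -mulmxE mulmxA mulmx_sqr. Qed.

Lemma riley_hom1 : phi 1 = ebasis r 0.
Proof. by rewrite /riley_hom rmorph1 mulmx1. Qed.

Lemma riley_homD p q : phi (p + q) = phi p + phi q.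
Proof. by rewrite -[p]scale1r riley_hom_linear !scale1r. Qed.

Lemma riley_hom0 : phi 0 = 0.
Proof. by rewrite /riley_hom rmorph0 mulmx0. Qed.

Lemma riley_homZ a p : phi (a *: p) = a *: phi p.
Proof. by rewrite -[a *: p]addr0 riley_hom_linear riley_hom0 addr0. Qed.

Lemma riley_hom_eps_mul k p : phi ((eps r s k)%:~R * p) = (eps r s k)%:~R *: phi p.
Proof. by rewrite mulrzl -scaler_int riley_homZ. Qed.

Lemma vmul_horner p (x y : 'rV[rat]_n.+1) :
  vmul r s (x *m horner_mx (M ^+ 2) p) y = vmul r s x y *m horner_mx (M ^+ 2) p.
Proof.
elim/poly_ind: p => [|p c IH].
  rewrite rmorph0 !mulmx0.
  (* Linearity with scalar -1 at zero vectors shows that a product with left factor 0 is 0. *)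
  by have := @vmul_linearl r s (-1) 0 0 y; rewrite scaler0 addr0 scaleN1r addNr.
rewrite rmorphD rmorphM /= horner_mx_X horner_mx_C -mulmxE !mulmxDr !mulmxA.
rewrite !mul_mx_scalar addrC vmul_linearl [RHS]addrC; congr (_ + _).
by rewrite !vmul_stepmx // IH.
Qed.

(** The polynomial in [M ^+ 2] defining [phi p] can be pulled out of the left factor, which leaves
    the unit [e_0] there. *)
Lemma riley_homM p q : phi (p * q) = vmul r s (phi p) (phi q).
Proof.
by rewrite [X in vmul _ _ X]/riley_hom vmul_horner vmul_ebasis0 mulrC
  /riley_hom rmorphM -mulmxE mulmxA.
Qed.

(** Both sides obey the same recurrence. The extra factor [M] at odd indices is needed because [phi]
    involves only even powers of [e_1]. The even range includes [n + 1 = r - 1], where the basis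
    vector is 0. *)
Lemma riley_hom_continuant m :
  ((m.*2 <= n.+1)%N ->
     phi (continuant r s m.*2 0) = (sfact r s m.*2)%:~R *: ebasis r m.*2) /\
  ((m.*2 < n.+1)%N ->
     phi (continuant r s m.*2.+1 1) *m M = (sfact r s m.*2.+1)%:~R *: ebasis r m.*2.+1).
Proof.
elim: m => [|m [IH0 IH1]].
  split=> _; first by rewrite continuant0 riley_hom1 sfact0 scale1r.
  rewrite continuant1 -[_%:~R]mulr1 riley_hom_eps_mul riley_hom1 -scalemxAl (@ebasis_stepmx r) //.
  by rewrite subr0 sfactS sfact0 mul1r.
have h0 : (m.+1.*2 <= n.+1)%N ->
     phi (continuant r s m.+1.*2 0) = (sfact r s m.+1.*2)%:~R *: ebasis r m.+1.*2.
  rewrite doubleS => lt.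
  rewrite -doubleS continuant_doubleS riley_homD riley_hom_eps_mul riley_homMX IH0 ?IH1; try lia.
  rewrite -scalemxAl (@ebasis_stepmx r) // doubleS /= scalerBr !scalerBr !scalerA.
  (* The two multiples of [e_{2m}] cancel: their coefficients differ by squares of signs only. *)
  rewrite addrCA -!intrM [X in _ + X](_ : _ = 0) ?addr0; last first.
    rewrite -scalerBl (_ : _ - _ = 0) ?scale0r //; apply/eqP; rewrite subr_eq0.
    rewrite eqr_int sfactS; apply/eqP.
    transitivity (sfact r s m.*2 * (eps r s m.*2.+1 * eps r s m.*2.+1)
       * (eps r s m.*2.+2 * eps r s m.*2.+2)); last by ring.
    by rewrite !eps_sqr !mulr1.
  by rewrite (sfactS _ _ m.*2.+1) mulrC.
split=> // lt; rewrite continuant_doubleSS riley_homD riley_hom_eps_mul mulmxDl IH1 ?h0; try lia.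
rewrite -!scalemxAl (@ebasis_stepmx r) // doubleS /= !scalerBr !scalerA.
rewrite addrCA -!intrM [X in _ + X](_ : _ = 0) ?addr0; last first.
  rewrite -scalerBl (_ : _ - _ = 0) ?scale0r //; apply/eqP; rewrite subr_eq0.
  rewrite eqr_int (sfactS _ _ m.*2.+1); apply/eqP.
  transitivity (sfact r s m.*2.+1 * (eps r s m.*2.+2 * eps r s m.*2.+2)
     * (eps r s m.*2.+3 * eps r s m.*2.+3)); last by ring.
  by rewrite !eps_sqr !mulr1.
by rewrite (sfactS _ _ m.*2.+2) mulrC.
Qed.

(** * Image and kernel for odd [r] *)

Hypothesis odd_r : odd r.

(** As [r - 1] is even, the Riley polynomial is the even continuant of index [r - 1], sent to a
    multiple of [e_{r-1} = 0]. *)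
Lemma riley_hom_riley : phi (riley r s) = 0.
Proof.
have := (riley_hom_continuant n.+1./2).1.
have -> : n.+1./2.*2 = n.+1 by have := odd_r; lia.
by rewrite ebasis_eq0 // scaler0 /continuant => /(_ (leqnn _)).
Qed.

Lemma size_riley : size (riley r s) = n.+1./2.+1.
Proof.
have := (size_continuant r s n.+1./2).1.
by have -> : n.+1./2.*2 = n.+1 by have := odd_r; lia.
Qed.

(** [M] switches the parity of the index, so its square preserves it. *)
Lemma Vplus_riley_hom p : Vplus r (phi p).
Proof.
have M0 (i l : 'I_n.+1) : odd i = odd l -> M i l = 0.
  move=> eo; rewrite mxE.
  have /negbTE -> : (l : nat) != i.+1 by apply/eqP => e; move: eo; rewrite e /=; case: odd.
  have /negbTE -> : (i : nat) != l.+1 by apply/eqP => e; move: eo; rewrite e /=; case: odd.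
  by rewrite mulr0 subr0.
elim/poly_ind: p => [|p c IH] k ok; first by rewrite riley_hom0 mxE.
rewrite riley_homD riley_homMX -alg_polyC riley_homZ riley_hom1 !mxE big1 => [|j _].
  by rewrite add0r; case: (k : nat) ok => // k'; rewrite mulr0.
have [oj | ej] := boolP (odd j); first by rewrite M0 ?mulr0 // oj ok.
rewrite mxE big1 ?mul0r // => i _; have [oi | ei] := boolP (odd i).
  by rewrite IH ?mul0r.
by rewrite M0 ?mulr0 // (negbTE ej) (negbTE ei).
Qed.

Lemma riley_hom_surj v : Vplus r v -> exists p, phi p = v.
Proof.
(* The even continuants map to the [e_{2m}] up to the sign [sfact], which the coefficients undo. *)
move=> Vv; exists (\sum_(m < n.+1./2)
  (v 0 (inord m.*2) * (sfact r s m.*2)%:~R) *: continuant r s m.*2 0).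
rewrite (big_morph phi riley_homD riley_hom0).
transitivity (\sum_(m < n.+1./2) v 0 (inord m.*2) *: ebasis r m.*2).
  apply: eq_bigr => m _; have lt := ltn_ord m.
  rewrite riley_homZ (riley_hom_continuant m).1; last lia.
  by rewrite scalerA -mulrA -intrM sfact_sqr mulr1.
apply/rowP => k; rewrite summxE.
have [ok | ek] := boolP (odd k).
  rewrite [RHS]Vv // big1 // => m _; rewrite !mxE; case: eqP => [e | _]; last by rewrite mulr0.
  by rewrite e odd_double in ok.
rewrite (eq_bigr (fun m : 'I_n.+1./2 => (m == k./2 :> nat)%:R * v 0 (inord m.*2))).
  rewrite (sum_ord_delta _ _ (fun m => v 0 (inord m.*2))).
  have := ltn_ord k; rewrite [(k < _)%N]/= => lt.
  rewrite ifT; last by have := odd_r; lia.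
  by rewrite (_ : k./2.*2 = k) ?inord_val //; lia.
move=> m _; rewrite !mxE mulrC; congr (_%:R * _).
by congr nat_of_bool; apply/eqP/eqP => [-> | ->]; rewrite ?doubleK ?even_halfK.
Qed.

(** Unitriangularity: [e_0 M^m] is [e_m] plus terms of lower index. *)
Lemma ebasis0_expS m (k : 'I_n.+1) : (m <= k)%N ->
  (ebasis r 0 *m M ^+ m) 0 k = (m == k :> nat)%:R.
Proof.
elim: m k => [|m IH] k le.
  by rewrite expr0 mulmx1 mxE eq_sym.
rewrite exprSr -mulmxE mulmxA mxE (bigD1 (inord k.-1)) //= big1 => [|j jk].
  rewrite IH ?inordK; try by [lia | have := ltn_ord k; lia].
  rewrite mxE inordK; last by have := ltn_ord k; lia.
  rewrite prednK; last lia.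
  rewrite eqxx [(_ == k.+1)](_ : _ = false) ?mulr0 ?subr0 ?mulr1 ?addr0; last lia.
  by congr (_%:R); lia.
have jk' : (j : nat) != k.-1.
  by apply: contraNneq jk => e; apply/eqP/val_inj; rewrite /= inordK // -e ltn_ord.
rewrite [X in _ * X]mxE; have -> : (k == j.+1 :> nat) = false by lia.
(* The other possible contribution has [j = k + 1], beyond the top index [m] of the previous
   power. *)
case: eqP => [e|_]; last by rewrite mulr0 subr0 mulr0.
have mk : (m < k.+1)%N by rewrite ltnS ltnW.
by rewrite IH e ?(ltn_eqF mk) ?mul0r // ltnW.
Qed.

(** If [p] has degree [d], the bound puts [2d] below [r - 1], and by unitriangularity the coordinate
    of [phi p] at [e_{2d}] is the leading coefficient. *)
Lemma riley_hom_inj (p : {poly rat}) : (size p <= n.+1./2)%N -> phi p = 0 -> p = 0.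
Proof.
move=> le e; apply/eqP; rewrite -size_poly_eq0; case: posnP => // gt.
have lt : ((size p).-1.*2 < n.+1)%N by lia.
have : phi p 0 (Ordinal lt) = lead_coef p.
  rewrite -[p in phi p]coefK poly_def (big_morph phi riley_homD riley_hom0) summxE.
  rewrite (eq_bigr (fun i : 'I_(size p) => (i == (size p).-1 :> nat)%:R * p`_i)).
    by rewrite sum_ord_delta ifT // prednK.
  move=> i _; have := ltn_ord i => li.
  rewrite riley_homZ mxE mulrC; congr (_ * _).
  have le2 : (2 * i <= (size p).-1.*2)%N by lia.
  rewrite /riley_hom rmorphXn /= horner_mx_X -exprM ebasis0_expS //=.
  by congr _%:R; lia.
by rewrite e mxE => /esym/eqP; rewrite lead_coef_eq0 -size_poly_eq0 eqn0Ngt gt.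
Qed.

(** The remainder modulo the Riley polynomial is also killed, and its degree is small enough for
    [riley_hom_inj]. *)
Lemma riley_hom_ker p : phi p = 0 <-> (riley r s %| p)%R.
Proof.
have R0 : riley r s != 0 by rewrite -size_poly_gt0 size_riley.
have mulR q : phi (q * riley r s) = 0.
  by rewrite mulrC /riley_hom rmorphM -mulmxE mulmxA -/(phi _) riley_hom_riley mul0mx.
split=> [e | /dvdpP[q ->] //].
have rem0 : phi (p %% riley r s) = 0.
  by rewrite -[LHS]add0r -{1}(mulR (p %/ riley r s)) -riley_homD -divp_eq.
rewrite /dvdp (riley_hom_inj _ rem0) //.
by rewrite -ltnS -size_riley ltn_modp.
Qed.

End RileyHom.

(** The isomorphism is given as a surjective unital algebra map onto the even part whose kernel is
    the ideal of the Riley polynomial. *)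
Theorem theorem1 (r s : nat) :
  (3 <= r)%N -> odd r -> odd s -> (0 < s < r)%N -> coprime r s ->
  exists phi : {poly rat} -> 'rV[rat]_(r.-1),
    (forall (a : rat) (p q : {poly rat}), phi (a *: p + q) = a *: phi p + phi q) /\
        phi 1 = ebasis r 0 /\
        (forall p q : {poly rat}, phi (p * q) = vmul r s (phi p) (phi q)) /\
        (forall p : {poly rat}, Vplus r (phi p)) /\
        (forall v : 'rV[rat]_(r.-1), Vplus r v -> exists p, phi p = v) /\
        (forall p : {poly rat}, phi p = 0 <-> (riley r s %| p)%R).
Proof.
(* With [r = n + 2] the square matrices have size [n + 1] and form a ring. *)
case: r => [|[|n]] // r3 odd_r odd_s /andP[s0 _] co.
exists (riley_hom n s); split; first exact: riley_hom_linear.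
split; first exact: riley_hom1.
split; first exact: riley_homM.
split; first exact: Vplus_riley_hom.
split; first exact: riley_hom_surj.
exact: riley_hom_ker.
Qed.
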